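(* For every $\varepsilon > 0$ there exist $n_0$ and $\eta > 0$ such that the following holds for every $n \ge n_0$. If $\mathcal H$ is an $n$-vertex linear hypergraph with maximum degree at most $\eta n$ and with no edge $e\in\mathcal H$ satisfying $\eta\sqrt n < |e| < \sqrt n/\eta$, then $\chi'(\mathcal H) \le \varepsilon n$.
   Context: A hypergraph $\mathcal H$ consists of a finite vertex set $V(\mathcal H)$ and a set of edges, each a nonempty subset of $V(\mathcal H)$ (singleton edges allowed, no repeated edges). $\mathcal H$ is linear if any two distinct edges intersect in at most one vertex. The degree of a vertex is the number of edges containing it. $\chi'(\mathcal H)$ denotes the chromatic index: the minimum number of colours in an assignment of colours to edges in which any two distinct edges sharing a vertex get different colours. *)

(* Defs.v *)
From mathcomp Require Import all_boot all_order all_algebra.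
From mathcomp Require Import reals.
Set Implicit Arguments. Unset Strict Implicit. Unset Printing Implicit Defensive.

Definition hypergraph (n : nat) (E : {set {set 'I_n}}) : Prop :=
  forall e, e \in E -> e != set0.

Definition linear_hg (n : nat) (E : {set {set 'I_n}}) : Prop :=
  forall e f, e \in E -> f \in E -> e != f -> #|e :&: f| <= 1.

Definition hdeg (n : nat) (E : {set {set 'I_n}}) (v : 'I_n) : nat :=
  #|[set e in E | v \in e]|.

Definition proper_edge_colouring (n k : nat) (E : {set {set 'I_n}})
  (c : {ffun {set 'I_n} -> 'I_k}) : bool :=
  [forall e in E, forall f in E, (e != f) && (e :&: f != set0) ==> (c e != c f)].

Definition edge_colourable (n : nat) (E : {set {set 'I_n}}) (k : nat) : bool :=
  [exists c : {ffun {set 'I_n} -> 'I_k}, proper_edge_colouring E c].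

(* Colouring each edge by its index in enum E uses #|E|.+1 colours (the
   spare colour is for non-edges). *)
Lemma edge_colourable_exists (n : nat) (E : {set {set 'I_n}}) :
  exists k, edge_colourable E k.
Proof.
exists #|E|.+1; apply/existsP.
exists [ffun e => (inord (index e (enum E)) : 'I_#|E|.+1)].
apply/forallP => e; apply/implyP => eE; apply/forallP => f; apply/implyP => fE.
apply/implyP => /andP [nef _]; rewrite !ffunE; apply/negP => /eqP H.
have eE' : e \in enum E by rewrite mem_enum.
have fE' : f \in enum E by rewrite mem_enum.
have ie : (index e (enum E) < #|E|.+1)%N by rewrite cardE ltnS ltnW // index_mem.
have iF : (index f (enum E) < #|E|.+1)%N by rewrite cardE ltnS ltnW // index_mem.
move: H => /(congr1 (@nat_of_ord _)); rewrite !inordK // => H.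
by move: nef; rewrite -(nth_index e eE') H (nth_index e fE') eqxx.
Qed.

Definition chromatic_index (n : nat) (E : {set {set 'I_n}}) : nat :=
  ex_minn (edge_colourable_exists E).

(* Main.v *)
(* Edges larger than sqrt n / eta are so few that they get private colours, and
   edges of bounded size meet at most eps n / 8 others, so they are coloured
   greedily. The remaining edges are split into classes
   C^j <= |e| < C^(j+1), and the classes with j even and with j odd are treated
   with separate palettes.

   Within one class the line graph has maximum degree O(C n), and any two
   meeting edges have few common neighbours. In the hard-core model of small
   fugacity on such a graph every vertex v satisfies
     beta P(v in I) + gamma E|I cap N(v)| >= 1,
   and running this model repeatedly on the not yet saturated vertices gives a
   fractional colouring, that is, a random matching containing every edge of the
   class with probability exactly p = C / (4 n). Sampling all classes of one
   parity independently and dropping every edge that meets a chosen edge of a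
   higher class loses at most a factor 2, because an edge meets at most
   2 n / C edges of higher classes.

   Using eps n / 16 such random matchings as colour classes leaves each edge with
   fewer than eps n / 16 uncoloured neighbours of at least its own size, and one
   finishes greedily in order of decreasing size. The matchings are chosen one
   after the other so that the sum over e of exp(s X_e), where X_e counts these
   uncoloured neighbours, does not exceed its expectation; since a matching
   contains at most |e| <= sqrt n neighbours of e, s = 1 / sqrt n is allowed. *)
Require Import Defs.
From mathcomp Require Import all_boot all_order all_algebra.
From mathcomp Require Import reals.
From mathcomp Require Import sequences exp.
From mathcomp Require Import ring lra zify.
Set Implicit Arguments. Unset Strict Implicit. Unset Printing Implicit Defensive.
Import Order.TTheory GRing.Theory Num.Theory.
Local Open Scope ring_scope.

(** * The hard-core model on locally sparse graphs *)

Lemma disjoint_setU1 (T : finType) (x : T) (A B : {set T}) :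
  [disjoint x |: A & B] = (x \notin B) && [disjoint A & B].
Proof. by rewrite -!setI_eq0 setIUl setU_eq0 !setI_eq0 disjoints1. Qed.

Definition indep (T : finType) (adj : rel T) (I : {set T}) : bool :=
  [forall u in I, forall v in I, ~~ adj u v].

Definition nbr (T : finType) (adj : rel T) (u : T) : {set T} :=
  [set v | adj u v].

Section Independent.

Variables (T : finType) (adj : rel T).
Hypotheses (adj_sym : symmetric adj) (adj_irr : irreflexive adj).

Implicit Types (I J A B F S : {set T}) (u v w : T).

Notation indep := (indep adj).
Notation N := (nbr adj).

Lemma indepP I : reflect {in I &, forall u v, ~~ adj u v} (indep I).
Proof.
apply: (iffP forall_inP) => [H u v uI vI | H u uI].
  by move/forall_inP: (H u uI); apply.
by apply/forall_inP => v vI; apply: H.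
Qed.

Lemma indep0 : indep set0.
Proof. by apply/indepP => u v; rewrite inE. Qed.

Lemma indepS A B : A \subset B -> indep B -> indep A.
Proof.
by move=> /subsetP AB /indepP iB; apply/indepP => u v /AB uB /AB; exact: iB.
Qed.

Lemma indepU A B : indep (A :|: B) =
  [&& indep A, indep B & [forall u in A, [disjoint N u & B]]].
Proof.
apply/idP/idP => [iAB|/and3P[/indepP iA /indepP iB /forall_inP dAB]].
  rewrite (indepS _ iAB) ?subsetUl// (indepS _ iAB) ?subsetUr//=.
  apply/forall_inP => u uA; rewrite disjoints_subset; apply/subsetP => v.
  rewrite !inE => auv; apply/negP => vB; move/indepP: iAB => /(_ u v).
  by rewrite !inE uA vB orbT auv => /(_ isT isT).
have aAB u v : u \in A -> v \in B -> ~~ adj u v.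
  move=> uA vB; apply/negP => auv.
  by have /disjointFl/(_ vB) := dAB _ uA; rewrite inE auv.
apply/indepP => u v; rewrite !inE => /orP[uA|uB] /orP[vA|vB].
- exact: iA.
- exact: aAB.
- by rewrite adj_sym; apply: aAB.
- exact: iB.
Qed.

Lemma indep1 u : indep [set u].
Proof. by apply/indepP => v w; rewrite !inE => /eqP-> /eqP->; rewrite adj_irr. Qed.

Lemma indepU1 u A : indep (u |: A) = indep A && [disjoint N u & A].
Proof.
rewrite indepU indep1 /=; congr (_ && _).
apply/forall_inP/idP => [->//|d v]; first by rewrite inE.
by rewrite inE => /eqP->.
Qed.

Variable R : realType.

(** Deleting [u] matches independent sets through [u] with independent sets that avoid its closed
    neighbourhood. *)
Lemma sum_indep_mem (S : {set T}) u (f : {set T} -> R) : u \in S ->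
  \sum_(I : {set T} | (I \subset S) && indep I && (u \in I)) f I =
  \sum_(A : {set T} | (A \subset S :\: (u |: N u)) && indep A) f (u |: A).
Proof.
move=> uS.
rewrite (reindex_onto (fun A => u |: A) (fun I => I :\ u)) /=; last first.
  by move=> I /andP[_ uI]; rewrite setD1K.
apply: eq_bigl => A; rewrite setU11 andbT indepU1 subUset sub1set uS /=.
have -> : ((u |: A) :\ u == A) = (u \notin A).
  apply/eqP/idP => [<-|uA]; first by rewrite !inE eqxx.
  by rewrite setU1K.
rewrite subsetD [[disjoint A & _]]disjoint_sym disjoint_setU1.
case: (A \subset S) => //=; case: (indep A) => //=; rewrite ?andbF ?andbT//.
by rewrite andbC.
Qed.

(** Markov property of the model: once the part [J] outside [B] is fixed, the part inside [B] is any
    independent set of vertices not blocked by [J]. *)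
Lemma sum_indep_split S B (f : {set T} -> R) :
  \sum_(I : {set T} | (I \subset S) && indep I) f I =
  \sum_(J : {set T} | (J \subset S :\: B) && indep J)
    \sum_(A : {set T} |
      (A \subset [set u in S :&: B | [disjoint N u & J]]) && indep A)
      f (J :|: A).
Proof.
rewrite (partition_big (fun I => I :\: B)
  (fun J => (J \subset S :\: B) && indep J)) /=; last first.
  by move=> I /andP[IS iI]; rewrite setSD// (indepS _ iI)// subsetDl.
apply: eq_bigr => J /andP[JSB iJ].
rewrite (reindex_onto (fun A => J :|: A) (fun I => I :&: B)) /=; last first.
  by move=> I /andP[_ /eqP<-]; rewrite setUC setID.
move: JSB; rewrite subsetD => /andP[JS JB].
apply: eq_bigl => A; rewrite setDUl setIUl.
have -> : J :\: B = J by apply/setDidPl.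
have -> : J :&: B = set0 by apply/eqP; rewrite setI_eq0.
rewrite set0U subUset JS /= [J :|: A]setUC indepU iJ /=.
have -> : (A :&: B == A) = (A \subset B) by apply/eqP/setIidPl.
apply/idP/idP.
  move=> /andP[/andP[/and3P[AS iA /forall_inP dAJ] _] AB].
  rewrite iA andbT; apply/subsetP => u uA; rewrite !inE.
  by rewrite (subsetP AS)// (subsetP AB)// dAJ.
move=> /andP[/subsetP AF iA]; rewrite iA /= -!andbA; apply/and4P; split.
- by apply/subsetP => u /AF; rewrite !inE => /andP[/andP[]].
- by apply/forall_inP => u /AF; rewrite !inE => /andP[].
- apply/eqP/setUidPl; apply/subsetP => u; rewrite inE => /andP[uB /AF].
  by rewrite !inE (negbTE uB) andbF.
- by apply/subsetP => u /AF; rewrite !inE => /andP[/andP[]].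
Qed.

Variable lam : R.
Hypotheses (lam_gt0 : 0 < lam).

(* The partition function of the hard-core model at fugacity [lam]. *)
Definition hcZ S : R :=
  \sum_(I : {set T} | (I \subset S) && indep I) lam ^+ #|I|.

Let lamX_ge0 n : 0 <= lam ^+ n. Proof. by rewrite exprn_ge0// ltW. Qed.

Lemma hcZS S S' : S \subset S' -> hcZ S <= hcZ S'.
Proof.
move=> SS'; rewrite /hcZ big_mkcond [leRHS]big_mkcond; apply: ler_sum => I _.
case: (boolP (I \subset S)) => [IS|_] /=.
  by rewrite (subset_trans IS SS').
by case: ifP.
Qed.

Lemma hcZ_ge1 S : 1 <= hcZ S.
Proof.
rewrite /hcZ (bigD1 set0) /= ?sub0set ?indep0// cards0 expr0 lerDl.
by apply: sumr_ge0.
Qed.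

Lemma hcZ_mem S u : u \in S ->
  \sum_(I : {set T} | (I \subset S) && indep I && (u \in I)) lam ^+ #|I| =
  lam * hcZ (S :\: (u |: N u)).
Proof.
move=> uS; rewrite sum_indep_mem// mulr_sumr; apply: eq_bigr => A /andP[].
rewrite subsetD disjoint_sym disjoint_setU1 => /andP[_ /andP[uA _]] _.
by rewrite cardsU1 uA exprS.
Qed.

Lemma hcZ_rec S u : u \in S ->
  hcZ S = hcZ (S :\ u) + lam * hcZ (S :\: (u |: N u)).
Proof.
move=> uS; rewrite -hcZ_mem// /hcZ (bigID (fun I : {set T} => u \in I)) /= addrC.
congr (_ + _); apply: eq_bigl => I.
by rewrite subsetD1 -andbA [indep I && _]andbC andbA.
Qed.

Lemma hcZD1 S u : hcZ S <= (1 + lam) * hcZ (S :\ u).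
Proof.
have [uS|uS] := boolP (u \in S); last first.
  have -> : S :\ u = S by apply/setDidPl; rewrite disjoint_sym disjoints1.
  by rewrite mulrDl mul1r lerDl mulr_ge0 ?(ltW lam_gt0)// (le_trans ler01)// hcZ_ge1.
rewrite (hcZ_rec uS) mulrDl mul1r lerD2l ler_wpM2l ?(ltW lam_gt0)//.
by rewrite hcZS// setDS// sub1set setU11.
Qed.

Lemma hcZD S B : hcZ S <= (1 + lam) ^+ #|B| * hcZ (S :\: B).
Proof.
have [n] := ubnP #|B|; elim: n => // n IH in S B *.
rewrite ltnS => cB; have [->|[u uB]] := set_0Vmem B.
  by rewrite cards0 mul1r setD0.
rewrite (cardsD1 u) uB exprS -mulrA; apply: le_trans (hcZD1 S u) _.
rewrite ler_wpM2l// ?addr_ge0// ?(ltW lam_gt0)//.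
rewrite -{2}(setD1K uB) -setDDl; apply: IH.
by move: cB; rewrite (cardsD1 u) uB.
Qed.

Lemma sum_card_mem S (Q : {set T}) (w : {set T} -> R) :
  \sum_(I : {set T} | (I \subset S) && indep I) w I * #|I :&: Q|%:R =
  \sum_(u in Q) \sum_(I : {set T} | (I \subset S) && indep I && (u \in I)) w I.
Proof.
rewrite (exchange_big_dep (fun I => (I \subset S) && indep I)) /=; last first.
  by move=> u I _ /andP[].
apply: eq_bigr => I /andP[IS iI]; rewrite IS iI /=.
rewrite sumr_const mulr_natr; congr (_ *+ _).
by apply: eq_card => u; rewrite !inE andbC.
Qed.

(** Sets through a vertex of [F] weigh [lam] times the partition function of [F] minus its closed
    neighbourhood, and deleting these at most [d.+1] vertices costs a factor of at most 2. *)
Lemma hc_occupancy_sparse F (d : nat) :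
  (forall u, u \in F -> (#|N u :&: F| <= d)%N) -> (1 + lam) ^+ d.+1 <= 2 ->
  lam / 2 * #|F|%:R * hcZ F <=
  \sum_(A : {set T} | (A \subset F) && indep A) lam ^+ #|A| * #|A|%:R.
Proof.
move=> Fd lam2.
have -> : \sum_(A : {set T} | (A \subset F) && indep A) lam ^+ #|A| * #|A|%:R
   = \sum_(A : {set T} | (A \subset F) && indep A) lam ^+ #|A| * #|A :&: F|%:R.
  by apply: eq_bigr => A /andP[/setIidPl-> _].
rewrite sum_card_mem mulrAC mulr_natr -sumr_const; apply: ler_sum => u uF.
rewrite hcZ_mem// -mulrA ler_wpM2l ?(ltW lam_gt0)//.
have -> : F :\: (u |: N u) = F :\: (u |: (N u :&: F)).
  by apply/setP => v; rewrite !inE; case: (v \in F); rewrite ?andbF ?andbT.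
rewrite mulrC ler_pdivrMr//; apply: le_trans (hcZD _ (u |: (N u :&: F))) _.
rewrite mulrC ler_wpM2l ?(le_trans ler01)// ?hcZ_ge1//.
apply: le_trans lam2; rewrite ler_weXn2l// ?lerDl ?(ltW lam_gt0)//.
by rewrite cardsU1 -add1n leq_add ?leq_b1 ?Fd.
Qed.

Lemma hcZ_le_expR S : hcZ S <= expR (lam * #|S|%:R).
Proof.
apply: le_trans (hcZD S S) _; rewrite setDv.
have -> : hcZ set0 = 1.
  rewrite /hcZ (bigD1 set0) /= ?sub0set ?indep0// cards0 expr0 big1 ?addr0//.
  by move=> I; rewrite subset0 => /andP[/andP[->]].
by rewrite mulr1 mulrC expRM_natl lerXn2r ?nnegrE ?expR_ge0 ?addr_ge0 ?(ltW lam_gt0)// expR_ge1Dx.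
Qed.

(* Either [F] is so large that its expected occupancy is at least [1 / gamma],
   or [hcZ F] is bounded and [v] itself is likely enough to be chosen. *)
Lemma hc_local_bound F (d : nat) (beta gamma : R) : lam <= 1 -> 0 < gamma ->
  (forall u, u \in F -> (#|N u :&: F| <= d)%N) -> (1 + lam) ^+ d.+1 <= 2 ->
  2 * expR (4 / gamma) <= beta * lam ->
  lam + hcZ F <= beta * lam +
    gamma * \sum_(A : {set T} | (A \subset F) && indep A) lam ^+ #|A| * #|A|%:R.
Proof.
move=> lam1 g0 Fd lam2 hb.
have hs := hc_occupancy_sparse Fd lam2.
set s := \sum_(A | _) _ in hs *.
have Z1 := hcZ_ge1 F.
have s0 : 0 <= s by apply: sumr_ge0 => A _; rewrite mulr_ge0.
have bl0 : 0 <= beta * lam by apply: le_trans hb; rewrite mulr_ge0 ?expR_ge0.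
have [hx|hx] := lerP (4 / gamma) (lam * #|F|%:R).
  have : 2 * hcZ F <= gamma * s; last by lra.
  apply: le_trans (ler_wpM2l (ltW g0) hs).
  rewrite mulrA ler_wpM2r ?(le_trans ler01)//.
  by move: hx; rewrite ler_pdivrMr// => hx; nra.
have : hcZ F <= expR (4 / gamma).
  by apply: le_trans (hcZ_le_expR F) _; rewrite ler_expR ltW.
have : 0 <= gamma * s by rewrite mulr_ge0 ?(ltW g0).
by lra.
Qed.

(** Fix the part [J] outside the closed neighbourhood of [v]. What remains is either [v] alone, of
    weight [lam], or an independent subset of the set [F] of neighbours left free by [J], so
    [hc_local_bound] applies for each [J]. *)
Lemma hc_local_occupancy S v (d : nat) (beta gamma : R) : lam <= 1 -> 0 < gamma ->
  v \in S -> (forall u, u \in S :&: N v -> (#|N u :&: N v :&: S| <= d)%N) ->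
  (1 + lam) ^+ d.+1 <= 2 -> 2 * expR (4 / gamma) <= beta * lam ->
  hcZ S <=
    beta * (\sum_(I : {set T} | (I \subset S) && indep I && (v \in I)) lam ^+ #|I|)
    + gamma * \sum_(u in N v)
       \sum_(I : {set T} | (I \subset S) && indep I && (u \in I)) lam ^+ #|I|.
Proof.
move=> lam1 g0 vS Sd lam2 hb.
have vN : v \notin N v by rewrite inE adj_irr.
have NS : (S :\ v) :&: N v = S :&: N v.
  by apply/setP => u; rewrite !inE; case: eqP => [->|]; rewrite ?adj_irr ?andbF.
rewrite hcZ_mem// (hcZ_rec vS) [X in X + _ <= _]/hcZ (sum_indep_split (S :\ v) (N v)).
rewrite -sum_card_mem setDDl /hcZ.
apply: (@le_trans _ _ (beta * (lam * \sum_(I : {set T} | (I \subset S :\: (v |: N v)) && indep I)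
   lam ^+ #|I|) + gamma * \sum_(I : {set T} | (I \subset S :\ v) && indep I)
     lam ^+ #|I| * #|I :&: N v|%:R)); last first.
  rewrite lerD2l ler_wpM2l ?(ltW g0)//.
  rewrite big_mkcond [leRHS]big_mkcond; apply: ler_sum => I _.
  rewrite subsetD1; case: (I \subset S) => //=; case: (indep I) => /=; last by rewrite andbF.
  by rewrite andbT; case: ifP => // _; rewrite mulr_ge0.
rewrite (sum_indep_split (S :\ v) (N v)) setDDl !mulr_sumr -!big_split /=.
apply: ler_sum => J /andP[]; rewrite subsetD => /andP[JS].
rewrite disjoint_sym disjoint_setU1 => /andP[vJ dNJ] iJ.
set F := [set u in _ | _].
have FN : F \subset N v.
  by apply/subsetP => u; rewrite !inE => /andP[/andP[]].
have cJA A : A \subset F -> #|J :|: A| = (#|J| + #|A|)%N.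
  move=> AF; rewrite cardsU; suff -> : J :&: A = set0 by rewrite cards0 subn0.
  apply/eqP; rewrite setI_eq0 disjoint_sym; apply: disjointWl dNJ.
  exact: subset_trans AF FN.
have -> : \sum_(A : {set T} | (A \subset F) && indep A) lam ^+ #|J :|: A| =
   lam ^+ #|J| * hcZ F.
  by rewrite mulr_sumr; apply: eq_bigr => A /andP[AF _]; rewrite cJA// exprD.
have -> : \sum_(A : {set T} | (A \subset F) && indep A)
    lam ^+ #|J :|: A| * #|(J :|: A) :&: N v|%:R =
  lam ^+ #|J| * \sum_(A : {set T} | (A \subset F) && indep A) lam ^+ #|A| * #|A|%:R.
  rewrite mulr_sumr; apply: eq_bigr => A /andP[AF _]; rewrite cJA// exprD mulrA.
  rewrite setIUl; have -> : J :&: N v = set0.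
    by apply/eqP; rewrite setI_eq0 disjoint_sym.
  by rewrite set0U; have /setIidPl-> := subset_trans AF FN.
have Fd u : u \in F -> (#|N u :&: F| <= d)%N.
  move=> uF; apply: leq_trans (Sd u _); last first.
    by move: uF; rewrite /F NS => /setIdP[].
  apply/subset_leq_card/subsetP => w; rewrite /F NS => /setIP[wu /setIdP[/setIP[wS wv] _]].
  by rewrite !in_setI wu wv wS.
have := hc_local_bound lam1 g0 Fd lam2 hb.
have := lamX_ge0 #|J|; set l := lam ^+ _; set s := \sum_(A | _) _ => l0 H.
have := ler_wpM2l l0 H; lra.
Qed.

End Independent.

(** * Random independent sets *)

Section Covers.

Variables (R : realType) (T : finType) (adj : rel T).
Hypotheses (adj_sym : symmetric adj) (adj_irr : irreflexive adj).

Implicit Types (I J A B F S V : {set T}) (u v : T).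

Notation indep := (indep adj).
Notation N := (nbr adj).

(* A random independent subset of [V] containing each element of [V] with
   probability between [a] and [b]. *)
Definition indep_cover V (a b : R) : Prop :=
  exists (Om : finType) (w : Om -> R) (X : Om -> {set T}),
  [/\ forall o, 0 <= w o, \sum_o w o = 1,
      forall o, indep (X o) && (X o \subset V)
    & forall v, v \in V -> a <= \sum_(o | v \in X o) w o <= b].

Definition indep_distr S (mu : {set T} -> R) : Prop :=
  [/\ forall I, 0 <= mu I,
      forall I, mu I != 0 -> indep I && (I \subset S)
    & \sum_I mu I = 1].

Definition marginal (mu : {set T} -> R) v : R := \sum_(I : {set T} | v \in I) mu I.

Lemma marginal_out S (mu : {set T} -> R) v :
  (forall I, mu I != 0 -> indep I && (I \subset S)) -> v \notin S ->
  marginal mu v = 0.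
Proof.
move=> supp vS; apply: big1 => I vI; apply/eqP; apply: contraNT vS.
by move=> /supp/andP[_ /subsetP]; apply.
Qed.

(** The normalised hard-core measure on [S] has zero marginals outside [S], so the neighbour sum may
    run over all of [V]. [fractional_colouring] needs this form, because saturated vertices still
    count as neighbours there. *)
Lemma hc_distr V (lam beta gamma : R) (d : nat) S v0 :
  0 < lam -> lam <= 1 -> 0 < gamma ->
  (forall u v, u \in V -> v \in V -> adj u v ->
     (#|N u :&: N v :&: V| <= d)%N) ->
  (1 + lam) ^+ d.+1 <= 2 -> 2 * expR (4 / gamma) <= beta * lam ->
  S \subset V -> v0 \in S ->
  exists mu : {set T} -> R, indep_distr S mu /\
    forall v, v \in S -> 0 < marginal mu v /\
      1 <= beta * marginal mu v + gamma * \sum_(u in N v :&: V) marginal mu u.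
Proof.
move=> lam0 lam1 g0 Vd lam2 hb SV v0S.
have Z0 : 0 < hcZ adj lam S by apply: lt_le_trans ltr01 (hcZ_ge1 _ lam0 _).
pose mu I : R := if (I \subset S) && indep I then lam ^+ #|I| / hcZ adj lam S else 0.
have muE v : marginal mu v = (\sum_(I : {set T} | (I \subset S) && indep I && (v \in I))
    lam ^+ #|I|) / hcZ adj lam S.
  rewrite /marginal mulr_suml big_mkcond [RHS]big_mkcond; apply: eq_bigr => I _.
  by rewrite /mu; case: (v \in I); rewrite ?andbT ?andbF.
have supp I : mu I != 0 -> indep I && (I \subset S).
  by rewrite /mu andbC; case: ifP => //; rewrite eqxx.
exists mu; split; first split=> //.
- by move=> I; rewrite /mu; case: ifP => // _; rewrite divr_ge0 ?exprn_ge0// ltW.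
- by rewrite -big_mkcond -mulr_suml divff// gt_eqF.
move=> v vS; split.
  rewrite muE hcZ_mem// divr_gt0// mulr_gt0// (lt_le_trans ltr01)// hcZ_ge1//.
have -> : \sum_(u in N v :&: V) marginal mu u = \sum_(u in N v) marginal mu u.
  rewrite [RHS](big_setID V) /= [X in _ = _ + X]big1 ?addr0// => u.
  rewrite inE => /andP[uV _]; apply: marginal_out supp _.
  by apply: contra uV; apply: (subsetP SV).
rewrite muE (eq_bigr _ (fun u _ => muE u)) -mulr_suml !mulrA -mulrDl.
rewrite ler_pdivlMr// mul1r.
apply: (hc_local_occupancy adj_sym adj_irr lam0 lam1 g0 vS _ lam2 hb) => u.
move=> /setIP[uS]; rewrite inE => auv; apply: leq_trans (Vd u v _ _ _).
- by rewrite subset_leq_card// setIS.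
- exact: (subsetP SV).
- exact: (subsetP SV).
- by rewrite adj_sym.
Qed.

(* Keep adding multiples of the distributions on the not yet saturated
   vertices, saturating at least one more each time. *)
Lemma fractional_colouring V (beta gamma : R) (D : nat) :
  0 <= beta -> 0 <= gamma ->
  (forall S v0, S \subset V -> v0 \in S ->
    exists mu : {set T} -> R, indep_distr S mu /\
    forall v, v \in S -> 0 < marginal mu v /\
      1 <= beta * marginal mu v + gamma * \sum_(u in N v :&: V) marginal mu u) ->
  (forall v, v \in V -> (#|N v :&: V| <= D)%N) ->
  exists W : {set T} -> R,
    [/\ forall I, 0 <= W I,
        forall I, W I != 0 -> indep I && (I \subset V),
        forall v, v \in V -> marginal W v = 1
      & \sum_I W I <= beta + gamma * D%:R].
Proof.
move=> b0 g0 Hmu HD.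
(* Induction on the set [S] of unsaturated vertices. The invariant bounds the total weight through
   the marginals around any [v] in [S]; adding a multiple of [mu], which has mass 1, preserves
   it. *)
have step n S (W : {set T} -> R) : (#|S| < n)%N -> S \subset V ->
  (forall I, 0 <= W I) -> (forall I, W I != 0 -> indep I && (I \subset V)) ->
  (forall v, v \in V -> marginal W v <= 1) ->
  (forall v, v \in V :\: S -> marginal W v = 1) ->
  (forall v, v \in S -> \sum_I W I <=
    beta * marginal W v + gamma * \sum_(u in N v :&: V) marginal W u) ->
  \sum_I W I <= beta + gamma * D%:R ->
  exists W' : {set T} -> R,
    [/\ forall I, 0 <= W' I,
        forall I, W' I != 0 -> indep I && (I \subset V),
        forall v, v \in V -> marginal W' v = 1
      & \sum_I W' I <= beta + gamma * D%:R].
  elim: n => // n IH in S W *.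
  rewrite ltnS => cS SV W0 suppW W1 Weq Winv Wtot.
  have [S0|[v0 v0S]] := set_0Vmem S.
    by exists W; split=> // v vV; apply: Weq; rewrite S0 setD0.
  have [mu [[mu0 muS mu1] mup]] := Hmu S v0 SV v0S.
  (* [t v] is the multiple of [mu] that saturates [v]; the smallest of them pushes no marginal above
     1. *)
  pose t v := (1 - marginal W v) / marginal mu v.
  have [v1 /= v1S v1min] := @Order.TotalTheory.arg_minP _ R T v0 (mem S) t v0S.
  have t0 : 0 <= t v1.
    rewrite divr_ge0//; last by have [/ltW] := mup _ v1S.
    by rewrite subr_ge0 W1// (subsetP SV).
  pose W' I := W I + t v1 * mu I.
  have margE v : marginal W' v = marginal W v + t v1 * marginal mu v.
    by rewrite /marginal big_split mulr_sumr.
  have totE : \sum_I W' I = \sum_I W I + t v1.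
    by rewrite big_split -mulr_sumr mu1 mulr1.
  have inv v : v \in S -> \sum_I W' I <=
      beta * marginal W' v + gamma * \sum_(u in N v :&: V) marginal W' u.
    move=> vS; rewrite totE margE (eq_bigr _ (fun u _ => margE u)) big_split -mulr_sumr.
    have := Winv v vS; have [_ /(ler_wpM2l t0)] := mup v vS.
    by rewrite mulr1 /=; lra.
  have marg1 v : v \in V -> marginal W' v <= 1.
    move=> vV; rewrite margE; have [vS|vS] := boolP (v \in S); last first.
      by rewrite (marginal_out muS vS) mulr0 addr0 W1.
    have := v1min v vS; rewrite {2}/t ler_pdivlMr; first by lra.
    by have [] := mup v vS.
  apply: (IH (S :\ v1) W').
  - by move: cS; rewrite (cardsD1 v1 S) [v1 \in S]v1S.
  - exact: subset_trans (subsetDl _ _) SV.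
  - move=> I; apply: addr_ge0; [exact: W0|apply: mulr_ge0; [exact: t0|exact: mu0]].
  - move=> I; rewrite /W'; have [->|WI _] := eqVneq (W I) 0; last exact: suppW.
    rewrite add0r mulf_eq0 negb_or => /andP[_ /muS/andP[-> IS]].
    exact: subset_trans IS SV.
  - exact: marg1.
  - move=> v; rewrite !inE negb_and negbK => /andP[/orP[/eqP->|vS] vV].
      rewrite margE /t divfK; first by lra.
      by have [/gt_eqF->] := mup _ v1S.
    by rewrite margE (marginal_out muS vS) mulr0 addr0 Weq// inE vS.
  - by move=> v /setD1P[_]; apply: inv.
  (* The invariant at [v0] bounds the new total, since all marginals are at most 1. *)
  - apply: le_trans (inv v0 v0S) _; have v0V := subsetP SV _ v0S.
    apply: lerD; first by rewrite ler_piMr// marg1.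
    rewrite ler_wpM2l//; apply: (@le_trans _ _ (\sum_(u in N v0 :&: V) 1)).
      by apply: ler_sum => u /setIP[_ uV]; rewrite marg1.
    by rewrite sumr_const ler_nat HD.
have m0 v : marginal (fun=> 0) v = 0 by apply: big1.
apply: (step _ V (fun=> 0) (ltnSn _)) => //.
- by move=> I; rewrite eqxx.
- by move=> v _; rewrite m0.
- by move=> v; rewrite setDv inE.
- by move=> v _; rewrite big1// m0 big1 ?mulr0 ?addr0.
- by rewrite big1// addr_ge0// mulr_ge0.
Qed.

(** Scaled by [p], the fractional colouring has mass at most 1; the missing mass goes to the empty
    set. *)
Lemma sparse_cover V (lam beta gamma p : R) (d D : nat) :
  0 < lam -> lam <= 1 -> 0 < gamma ->
  (forall u v, u \in V -> v \in V -> adj u v ->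
     (#|N u :&: N v :&: V| <= d)%N) ->
  (forall v, v \in V -> (#|N v :&: V| <= D)%N) ->
  (1 + lam) ^+ d.+1 <= 2 -> 2 * expR (4 / gamma) <= beta * lam ->
  0 <= p -> p * (beta + gamma * D%:R) <= 1 ->
  indep_cover V p p.
Proof.
move=> lam0 lam1 g0 Vd VD lam2 hb p0 pT.
have b0 : 0 <= beta.
  have : 0 <= beta * lam by apply: le_trans hb; rewrite mulr_ge0 ?expR_ge0.
  by rewrite pmulr_lge0.
have [W [W0 suppW W1 Wtot]] := fractional_colouring b0 (ltW g0)
  (fun S v0 => @hc_distr V lam beta gamma d S v0 lam0 lam1 g0 Vd lam2 hb) VD.
(* Every outcome must yield an independent subset of [V], also those of weight 0 in [W]; these are
   sent to the empty set. *)
pose X I : {set T} := if W I == 0 then set0 else I.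
pose w I : R := p * W I + (1 - p * \sum_I W I) * (I == set0)%:R.
exists {set T}, w, X; split.
- move=> I; rewrite addr_ge0 ?mulr_ge0// subr_ge0.
  exact: le_trans (ler_wpM2l p0 Wtot) pT.
- rewrite big_split -mulr_sumr -mulr_sumr /=.
  have -> : \sum_(I : {set T}) (I == set0)%:R = 1 :> R.
    by rewrite (bigD1 set0)//= eqxx big1 ?addr0// => I /negPf->.
  by rewrite mulr1 addrC subrK.
- move=> I; rewrite /X; case: eqP => [_|/eqP]; last exact: suppW.
  by rewrite indep0 sub0set.
- move=> v vV; suff -> : \sum_(I | v \in X I) w I = p by rewrite lexx.
  rewrite -[RHS]mulr1 -(W1 v vV) mulr_sumr big_mkcond [RHS]big_mkcond.
  apply: eq_bigr => I _; rewrite /X /w; case: eqP => [->|_].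
    by rewrite inE mulr0; case: ifP.
  have [vI|//] := boolP (v \in I).
  suff -> : (I == set0) = false by rewrite mulr0 addr0.
  by apply/eqP => I0; rewrite I0 inE in vI.
Qed.

Lemma indep_cover0 (a b : R) : indep_cover set0 a b.
Proof.
exists unit, (fun=> 1), (fun=> set0); split=> // [|_|v].
- by rewrite big_const card_unit /= addr0.
- by rewrite indep0 sub0set.
- by rewrite inE.
Qed.

(* Sample both sets independently, and drop from the second one every vertex
   with a neighbour in the first. *)
Lemma indep_coverU V1 V2 (p : R) : 0 <= p -> [disjoint V1 & V2] ->
  indep_cover V1 (p / 2) p -> indep_cover V2 p p ->
  (forall v, v \in V2 -> #|N v :&: V1|%:R * p <= 1 / 2) ->
  indep_cover (V1 :|: V2) (p / 2) p.
Proof.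
move=> p0 dV [O1 [w1 [X1 [w10 w11 iX1 m1]]]] [O2 [w2 [X2 [w20 w21 iX2 m2]]]] nb.
pose X (o : O1 * O2) := X1 o.1 :|: [set v in X2 o.2 | [disjoint N v & X1 o.1]].
exists (O1 * O2)%type, (fun o => w1 o.1 * w2 o.2), X; split.
- by move=> o; rewrite mulr_ge0.
- rewrite -(pair_bigA _ (fun o1 o2 => w1 o1 * w2 o2)) /= -[RHS]w11.
  by apply: eq_bigr => o1 _; rewrite -mulr_sumr w21 mulr1.
- move=> [o1 o2]; rewrite /X /=.
  have /andP[i1 s1] := iX1 o1; have /andP[i2 s2] := iX2 o2.
  rewrite subUset (subset_trans s1 (subsetUl _ _)) /= setUC indepU// i1.
  rewrite (indepS _ i2) /=; last by apply/subsetP => v /setIdP[].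
  apply/andP; split; first by apply/forall_inP => v /setIdP[].
  apply/subsetP => v /setIdP[vX _]; rewrite inE (subsetP s2 _ vX) orbT //.
have X1V o v : v \in X1 o -> v \in V1 by have /andP[_ /subsetP] := iX1 o; apply.
have X2V o v : v \in X2 o -> v \in V2 by have /andP[_ /subsetP] := iX2 o; apply.
move=> v; rewrite inE => /orP[vV1|vV2].
  have -> : \sum_(o | v \in X o) w1 o.1 * w2 o.2 = \sum_(o1 | v \in X1 o1) w1 o1.
    transitivity (\sum_(o1 | v \in X1 o1) \sum_(o2 : O2) w1 o1 * w2 o2); last first.
      by apply: eq_bigr => o1 _; rewrite -mulr_sumr w21 mulr1.
    rewrite pair_big /=; apply: eq_bigl => -[o1 o2].
    rewrite !inE andbT /=; case: (v \in X1 o1) => //=; apply/negP => /andP[/X2V vV2 _].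
    by have := disjointFr dV vV1; rewrite vV2.
  exact: m1.
have -> : \sum_(o | v \in X o) w1 o.1 * w2 o.2 =
    (\sum_(o1 | [disjoint N v & X1 o1]) w1 o1) * \sum_(o2 | v \in X2 o2) w2 o2.
  transitivity (\sum_(o1 | [disjoint N v & X1 o1]) \sum_(o2 | v \in X2 o2) w1 o1 * w2 o2);
    last by rewrite mulr_suml; apply: eq_bigr => o1 _; rewrite -mulr_sumr.
  rewrite pair_big /=; apply: eq_bigl => -[o1 o2].
  rewrite !inE /= andbC; have [/X1V vV1|//] := boolP (v \in X1 o1).
  by have := disjointFr dV vV1; rewrite vV2.
have := m2 v vV2; set s2 := \sum_(o2 | _) _ => /andP[s2p ps2].
have {s2p ps2} -> : s2 = p by apply/le_anti/andP.
have dsum : \sum_(o1 | [disjoint N v & X1 o1]) w1 o1 +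
    \sum_(o1 | ~~ [disjoint N v & X1 o1]) w1 o1 = 1.
  by rewrite -w11 [RHS](bigID (fun o => [disjoint N v & X1 o])).
(* Union bound over the neighbours in [V1], each chosen with probability at most [p]. *)
have bad : \sum_(o1 | ~~ [disjoint N v & X1 o1]) w1 o1 <= 1 / 2.
  apply: le_trans (nb v vV2); rewrite mulr_natl -sumr_const.
  apply: (@le_trans _ _ (\sum_(u in N v :&: V1) \sum_(o | u \in X1 o) w1 o)); last first.
    by apply: ler_sum => u /setIP[_ uV1]; have /andP[] := m1 u uV1.
  rewrite (exchange_big_dep predT) //= big_mkcond; apply: ler_sum => o _.
  case: ifP => [|_]; last by apply: sumr_ge0.
  move=> /pred0Pn[u /andP[/= uN uX]]; rewrite (bigD1 u) /=; last first.
    by rewrite in_setI uN uX (X1V _ _ uX).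
  by rewrite lerDl; apply: sumr_ge0.
have bad0 : 0 <= \sum_(o1 | ~~ [disjoint N v & X1 o1]) w1 o1 by apply: sumr_ge0.
have : 1 / 2 <= \sum_(o1 | [disjoint N v & X1 o1]) w1 o1 <= 1 by lra.
by nra.
Qed.

(** Levels are added from the top down, so a vertex is dropped only because of neighbours of higher
    level. The factor 1/2 does not compound, because the conflict bound uses only the upper bound
    [p] on the marginals. *)
Lemma indep_cover_levels V (lev : T -> nat) (p : R) : 0 <= p ->
  (forall j, indep_cover [set v in V | lev v == j] p p) ->
  (forall v, v \in V -> #|[set u in N v :&: V | (lev v < lev u)%N]|%:R * p <= 1 / 2) ->
  indep_cover V (p / 2) p.
Proof.
move=> p0 Hlev Hnb; pose L := (\max_(v in V) lev v).+1.
suff /(_ L (leqnn _)) : forall k, (k <= L)%N ->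
    indep_cover [set v in V | (L - k <= lev v)%N] (p / 2) p.
  rewrite subnn; congr (indep_cover _ _ _).
  by apply/setP => v; rewrite inE andbT.
elim=> [_|k IH kL].
  have -> : [set v in V | (L - 0 <= lev v)%N] = set0.
    apply/setP => v; rewrite !inE subn0 ltnNge; have [vV|//] := boolP (v \in V).
    by rewrite (leq_bigmax_cond _ vV).
  exact: indep_cover0.
have -> : [set v in V | (L - k.+1 <= lev v)%N] =
   [set v in V | (L - k <= lev v)%N] :|: [set v in V | lev v == (L - k.+1)%N].
  apply/setP => v; rewrite !inE -andb_orr; congr (_ && _).
  by apply/idP/orP => [|[]]; lia.
apply: indep_coverU => //.
- rewrite -setI_eq0; apply/eqP/setP => v; rewrite !inE; apply/negP.
  by move=> /andP[/andP[_ ?] /andP[_ ?]]; lia.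
- by apply: IH; apply: ltnW.
- move=> v /setIdP[vV /eqP lv]; apply: le_trans (Hnb v vV).
  rewrite ler_wpM2r// ler_nat subset_leq_card//; apply/subsetP => u.
  by rewrite !inE lv => /and3P[-> -> ?] /=; lia.
Qed.

End Covers.

(** * Colourings from random independent sets *)

Section Colourings.

Variables (T : finType) (adj : rel T).
Hypotheses (adj_sym : symmetric adj) (adj_irr : irreflexive adj).

Implicit Types (I U V : {set T}) (u v : T).

Notation indep := (indep adj).
Notation N := (nbr adj).

(** Colours are plain natural numbers, bounded only on [V], so that palettes can be shifted and
    glued. *)
Definition colourable V (k : nat) : Prop :=
  exists c : T -> nat, (forall v, v \in V -> (c v < k)%N) /\
    forall u v, u \in V -> v \in V -> adj u v -> c u != c v.

Lemma colourableS V V' k k' : V \subset V' -> (k' <= k)%N ->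
  colourable V' k' -> colourable V k.
Proof.
move=> /subsetP VV' kk' [c [cV cP]]; exists c; split=> [v /VV' /cV|u v /VV' uV /VV'].
  by move/leq_trans; apply.
exact: cP.
Qed.

Lemma colourableU V1 V2 k1 k2 : colourable V1 k1 -> colourable V2 k2 ->
  colourable (V1 :|: V2) (k1 + k2).
Proof.
move=> [c1 [c1V c1P]] [c2 [c2V c2P]].
exists (fun v => if v \in V1 then c1 v else (k1 + c2 v)%N).
split=> [v|u v].
  rewrite inE; case: ifP => [vV1 _|_ /= /c2V]; last by rewrite ltn_add2l.
  by rewrite ltn_addr ?c1V.
rewrite !inE; case: ifP => [uV1 _|_ /= uV2]; case: ifP => [vV1 _|_ /= vV2] auv.
- exact: c1P.
- by have := c1V u uV1; apply: contraTneq => ->; rewrite -leqNgt leq_addr.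
- by have := c1V v vV1; apply: contraTneq => <-; rewrite -leqNgt leq_addr.
- by rewrite eqn_add2l; apply: c2P.
Qed.

Lemma colourable_indep I : indep I -> colourable I 1.
Proof.
move=> /indepP iI; exists (fun=> 0%N); split=> // u v uI vI auv.
by have := iI u v uI vI; rewrite auv.
Qed.

(** Colour a vertex of smallest rank last: all its neighbours in [V] have at least its rank, so they
    block fewer than [k] colours. *)
Lemma colourable_greedy V (rank : T -> nat) k :
  (forall v, v \in V -> (#|[set u in N v :&: V | (rank v <= rank u)%N]| < k)%N) ->
  colourable V k.
Proof.
have [n] := ubnP #|V|; elim: n => // n IH in V *.
rewrite ltnS => cV HV; have [->|[v0 v0V]] := set_0Vmem V.
  by exists (fun=> 0%N); split=> [v|u v]; rewrite inE.
have [v /= vV vmin] := @arg_minnP _ v0 (mem V) rank v0V.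
have [c [cV' cP]] : colourable (V :\ v) k.
  apply: IH => [|u /setD1P[_ uV]]; first by move: cV; rewrite (cardsD1 v) [_ \in _]vV.
  apply: leq_ltn_trans (HV u uV); apply/subset_leq_card/subsetP => w.
  by rewrite !inE => /andP[/and3P[-> _ ->]].
pose Q := [set u in N v :&: V | (rank v <= rank u)%N].
have [i ik iQ] : exists2 i, (i < k)%N & i \notin [seq c u | u in Q].
  have [/allP H|/allPn[i]] := boolP (all (mem [seq c u | u in Q]) (iota 0 k)).
    have := uniq_leq_size (iota_uniq 0 k) H.
    by rewrite size_iota size_image leqNgt HV.
  by rewrite mem_iota add0n; exists i.
exists (fun u => if u == v then i else c u); split=> [u uV|u w uV wV auw].
  by case: eqP => // /eqP uv; rewrite cV'// !inE uv.
have iQc x : x \in V -> adj v x -> i != c x.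
  move=> xV avx; apply: contraNneq iQ => ->; apply/imageP; exists x => //.
  by rewrite !inE avx xV /= vmin.
have [uv|uv] := eqVneq u v; have [wv|wv] := eqVneq w v.
- by rewrite uv wv adj_irr in auw.
- by apply: iQc => //; rewrite -uv.
- by rewrite eq_sym; apply: iQc => //; rewrite -wv adj_sym.
- by apply: cP => //; rewrite !inE ?uv ?wv.
Qed.

Lemma colourable_card V : colourable V #|V|.
Proof.
apply: (colourable_greedy (rank := fun=> 0%N)) => v vV.
rewrite (cardsD1 v V) vV add1n ltnS; apply/subset_leq_card/subsetP => u.
rewrite !inE => /andP[/andP[avu ->] _]; rewrite andbT.
by apply: contraTneq avu => ->; rewrite adj_irr.
Qed.

(** * Repeated removal of random independent sets *)

Variable R : realType.

(** Both sides compare with [1 / (1 + z)]. *)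
Lemma expRN_le_chord (z : R) : 0 <= z -> z <= 1 -> expR (- z) <= 1 - z / 2.
Proof.
move=> z0 z1; rewrite expRN -[leLHS]mul1r ler_pdivrMr ?expR_gt0//.
have := expR_ge1Dx z; nra.
Qed.

Lemma exists_le_average (Om : finType) (w f : Om -> R) (c : R) :
  (forall o, 0 <= w o) -> \sum_o w o = 1 -> \sum_o w o * f o <= c ->
  exists o, f o <= c.
Proof.
move=> w0 w1 fc; apply/existsP; apply: contraT; rewrite negb_exists => /forallP H.
have H' o : c < f o by rewrite ltNge H.
have [o wo] : exists o, 0 < w o.
  apply/existsP; apply: contraT; rewrite negb_exists => /forallP K.
  suff : \sum_o w o = 0 by rewrite w1 => /eqP; rewrite oner_eq0.
  by apply: big1 => o _; apply/le_anti; rewrite w0 leNgt K.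
have : \sum_o w o * c < \sum_o w o * f o.
  rewrite (bigD1 o)//= [ltRHS](bigD1 o)//= ltr_leD ?ltr_pM2l//.
  by apply: ler_sum => o' _; rewrite ler_wpM2l// ltW.
by rewrite -mulr_suml w1 mul1r ltNge fc.
Qed.

(** Some outcome does not exceed the expectation. For each [v], the chord bound linearises the
    exponential in the number of removed neighbours, whose mean is at least [a * #|A|]; then
    [1 - x <= exp(-x)] restores an exponential. *)
Lemma cover_step V U (M : T -> {set T}) (a b s : R) :
  indep_cover adj V a b -> U \subset V -> 0 <= s ->
  (forall I v, indep I -> I \subset V -> v \in V -> s * #|M v :&: I|%:R <= 1) ->
  exists2 I, indep I &
    \sum_(v in V) expR (s * #|M v :&: (U :\: I)|%:R) <=
    \sum_(v in V) expR (s * (1 - a / 2) * #|M v :&: U|%:R).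
Proof.
move=> [Om [w [X [w0 w1 iX mX]]]] UV s0 sM.
pose f o := \sum_(v in V) expR (s * #|M v :&: (U :\: X o)|%:R).
suff /(exists_le_average w0 w1)[o fo] : \sum_o w o * f o <=
    \sum_(v in V) expR (s * (1 - a / 2) * #|M v :&: U|%:R).
  by exists (X o) => //; have /andP[] := iX o.
rewrite (eq_bigr (fun o => \sum_(v in V) w o * expR (s * #|M v :&: (U :\: X o)|%:R)));
  last by move=> o _; rewrite mulr_sumr.
rewrite exchange_big /=; apply: ler_sum => v vV.
set A := M v :&: U.
have cE o : (#|M v :&: (U :\: X o)|%:R = #|A|%:R - #|A :&: X o|%:R :> R).
  by rewrite setIDA -/A -(cardsID (X o) A) natrD addrC addKr.
have sy o : s * #|A :&: X o|%:R <= 1.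
  have /andP[iXo sXo] := iX o; apply: le_trans (sM (X o) v iXo sXo vV).
  by rewrite ler_wpM2l// ler_nat subset_leq_card// setSI// subsetIl.
have avg : a * #|A|%:R <= \sum_o w o * #|A :&: X o|%:R.
  rewrite mulr_natr -sumr_const.
  apply: (@le_trans _ _ (\sum_(u in A) \sum_(o | u \in X o) w o)).
    apply: ler_sum => u; rewrite inE => /andP[_ uU].
    by have /andP[] := mX u (subsetP UV _ uU).
  rewrite (exchange_big_dep predT) //=; apply: ler_sum => o _.
  rewrite sumr_const mulr_natr le_eqVlt; apply/orP; left; apply/eqP; congr (_ *+ _).
  by apply: eq_card => u; rewrite [RHS]in_setI.
apply: (@le_trans _ _ (expR (s * #|A|%:R) * (1 - s * a * #|A|%:R / 2))); last first.
  rewrite [leRHS](_ : _ = expR (s * #|A|%:R) * expR (- (s * a * #|A|%:R / 2))).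
    by rewrite ler_wpM2l ?expR_ge0// expR_ge1Dx.
  by rewrite -expRD; congr expR; ring.
apply: (@le_trans _ _ (expR (s * #|A|%:R) *
    \sum_o w o * (1 - s * #|A :&: X o|%:R / 2))).
  rewrite mulr_sumr; apply: ler_sum => o _; rewrite mulrCA ler_wpM2l//.
  rewrite cE mulrBr expRD ler_wpM2l ?expR_ge0// expRN_le_chord ?sy//.
  by rewrite mulr_ge0.
rewrite ler_wpM2l ?expR_ge0//.
rewrite (eq_bigr (fun o => w o - s / 2 * (w o * #|A :&: X o|%:R))); last first.
  by move=> o _; ring.
rewrite sumrB w1 -mulr_sumr.
have : 0 <= s / 2 by rewrite divr_ge0.
by move=> /ler_wpM2l/(_ _ _ avg); lra.
Qed.

Lemma cover_iter V U (M : T -> {set T}) (a b s : R) (m : nat) :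
  indep_cover adj V a b -> 0 <= a -> a <= 1 -> U \subset V -> 0 <= s ->
  (forall I v, indep I -> I \subset V -> v \in V -> s * #|M v :&: I|%:R <= 1) ->
  exists U', [/\ U' \subset V,
    forall k, colourable U' k -> colourable U (m + k)
  & \sum_(v in V) expR (s * #|M v :&: U'|%:R) <=
    \sum_(v in V) expR (s * (1 - a / 2) ^+ m * #|M v :&: U|%:R)].
Proof.
move=> HV a0 a1 + s0 sM; elim: m U => [|m IH] U UV.
  by exists U; split=> //; rewrite mulr1.
have r0 : 0 <= (1 - a / 2) ^+ m by rewrite exprn_ge0//; lra.
have r1 : (1 - a / 2) ^+ m <= 1 by rewrite exprn_ile1//; lra.
(* The first round runs with the reduced parameter [s (1 - a/2)^m], so that the remaining [m] rounds
   lead back to [s]. *)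
have [|I v iI IV vV|I iI HI] := cover_step (M := M) (s := s * (1 - a / 2) ^+ m) HV UV.
- by rewrite mulr_ge0.
- apply: le_trans (sM I v iI IV vV); rewrite -mulrA ler_wpM2l//.
  by rewrite ler_piMl.
have [|U' [U'V cU' HU']] := IH (U :\: I); first exact: subset_trans (subsetDl _ _) UV.
exists U'; split=> // [k /cU' ck|].
  apply: (@colourableS _ ((U :\: I) :|: I) _ (m + k + 1)); last 2 first.
  - by rewrite addn1 addSn.
  - exact: colourableU ck (colourable_indep iI).
  by rewrite setDE setUIl [~: I :|: I]setUC setUCr setIT subsetUl.
apply: le_trans HU' (le_trans HI _); apply: ler_sum => v _.
by rewrite exprSr mulrA.
Qed.

(** A vertex left with [k] uncoloured neighbours of at least its rank would alone contribute
    [exp(s k)], more than the whole sum. Hence [k] further colours suffice greedily. *)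
Lemma colourable_cover V (rank : T -> nat) (a b s : R) (D m k : nat) :
  indep_cover adj V a b -> 0 <= a -> a <= 1 -> 0 <= s ->
  (forall I v, indep I -> I \subset V -> v \in V ->
     s * #|[set u in N v :&: V | (rank v <= rank u)%N] :&: I|%:R <= 1) ->
  (forall v, v \in V -> (#|[set u in N v :&: V | (rank v <= rank u)%N]| <= D)%N) ->
  #|V|%:R * expR (s * (1 - a / 2) ^+ m * D%:R) < expR (s * k%:R) ->
  colourable V (m + k).
Proof.
move=> HV a0 a1 s0 sM HD Hk.
pose M v := [set u in N v :&: V | (rank v <= rank u)%N].
have [U' [U'V cU' HU']] := cover_iter (M := M) m HV a0 a1 (subxx V) s0 sM.
apply/cU'/(colourable_greedy (rank := rank)) => v vU'.
have vV := subsetP U'V _ vU'.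
have -> : [set u in N v :&: U' | (rank v <= rank u)%N] = M v :&: U'.
  apply/setP => u; rewrite !inE; have [uU'|] := boolP (u \in U'); last by rewrite !andbF.
  by rewrite (subsetP U'V _ uU') !andbT.
rewrite ltnNge; apply/negP => kM; move: Hk; rewrite ltNge => /negP; apply.
apply: (@le_trans _ _ (expR (s * #|M v :&: U'|%:R))).
  by rewrite ler_expR ler_wpM2l// ler_nat.
apply: (@le_trans _ _ (\sum_(v in V) expR (s * #|M v :&: U'|%:R))).
  by rewrite (bigD1 v)//= lerDl sumr_ge0// => u _; rewrite expR_ge0.
apply: le_trans HU' _; rewrite mulr_natl -sumr_const; apply: ler_sum => u uV.
rewrite ler_expR ler_wpM2l//.
  by rewrite mulr_ge0// exprn_ge0//; lra.
rewrite ler_nat; apply: leq_trans (HD u uV).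
by rewrite subset_leq_card// subsetIl.
Qed.

End Colourings.

(** * Linear hypergraphs *)

Lemma leq_card_bigcup (I J : finType) (A : {set I}) (F : I -> {set J}) d :
  (forall x, x \in A -> (#|F x| <= d)%N) -> (#|\bigcup_(x in A) F x| <= #|A| * d)%N.
Proof.
move=> HF; apply: (@leq_trans (\sum_(x in A) #|F x|)); last first.
  by rewrite -sum_nat_const; apply: leq_sum.
elim/big_rec2: _ => [|x m B _ Bm]; first by rewrite cards0.
by rewrite (leq_trans (leq_card_setU _ _))// leq_add2l.
Qed.

Section LinearHypergraph.

Variable n : nat.
Implicit Types (e f g : {set 'I_n}) (E V : {set {set 'I_n}}) (x y z : 'I_n).

Definition meets : rel {set 'I_n} := fun e f => (e != f) && (e :&: f != set0).

Notation N := (nbr meets).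

Lemma meets_sym : symmetric meets.
Proof. by move=> e f; rewrite /meets eq_sym setIC. Qed.

Lemma meets_irr : irreflexive meets.
Proof. by move=> e; rewrite /meets eqxx. Qed.

Lemma linear_hgS E V : V \subset E -> linear_hg E -> linear_hg V.
Proof. by move=> /subsetP VE HE e f /VE eE /VE; apply: HE. Qed.

Lemma card_edges_pair E x y : linear_hg E -> x != y ->
  (#|[set e in E | (x \in e) && (y \in e)]| <= 1)%N.
Proof.
move=> HE xy; apply/card_le1_eqP => e f /setIdP[eE /andP[xe ye]] /setIdP[fE /andP[xf yf]].
apply/eqP; apply: contraT; rewrite eq_sym => ef; have := HE _ _ eE fE ef.
rewrite leqNgt => /negP[].
apply/card_gt1P; exists x, y; split=> //; rewrite inE; exact/andP.
Qed.

Lemma hdeg_linear_mul E x s : linear_hg E -> (forall e, e \in E -> (s <= #|e|)%N) ->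
  (hdeg E x * s.-1 <= n)%N.
Proof.
move=> HE Es; rewrite /hdeg -sum_nat_const -[leqRHS]card_ord -sum1_card.
apply: (@leq_trans (\sum_(e in [set e in E | x \in e]) \sum_(y in e :\ x) 1)%N).
  apply: leq_sum => e /setIdP[eE xe]; rewrite sum1_card.
  by have := Es e eE; rewrite (cardsD1 x) xe; case: s Es.
rewrite (exchange_big_dep predT) //=; apply: leq_sum => y _.
rewrite sum1_card; have [->|xy] := eqVneq x y.
  by rewrite eq_card0// => e; rewrite unfold_in /= !inE eqxx andbF.
apply: leq_trans (card_edges_pair HE xy); apply/subset_leq_card/subsetP => e.
by rewrite unfold_in /= !inE => /andP[/andP[-> ->] /andP[_ ->]].
Qed.

Lemma hdeg_linear E x s : (1 < s)%N -> linear_hg E ->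
  (forall e, e \in E -> (s <= #|e|)%N) -> (hdeg E x <= n %/ s.-1)%N.
Proof.
by move=> s1 HE Es; rewrite leq_divRL ?hdeg_linear_mul//; case: s s1 {Es} => [|[]].
Qed.

(** Double counting of incidences, each degree being bounded by [hdeg_linear_mul]. *)
Lemma card_linear E s : linear_hg E -> (forall e, e \in E -> (s <= #|e|)%N) ->
  (#|E| * s * s.-1 <= n * n)%N.
Proof.
move=> HE Es; apply: (@leq_trans ((\sum_(x : 'I_n) hdeg E x) * s.-1)); last first.
  rewrite big_distrl -[leqRHS](congr1 (muln^~ n) (card_ord n)) -sum_nat_const /=.
  by apply: leq_sum => x _; apply: hdeg_linear_mul.
rewrite leq_mul2r; apply/orP; right; rewrite -sum_nat_const.
apply: (@leq_trans (\sum_(e in E) \sum_(x in e) 1)%N).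
  by apply: leq_sum => e eE; rewrite sum1_card Es.
rewrite (exchange_big_dep predT) //=; apply: leq_sum => x _.
by rewrite sum1_card /hdeg leq_eqVlt; apply/orP; left; apply/eqP/eq_card => e; rewrite !inE.
Qed.

Lemma leq_card_nbr V d e : (forall x, (hdeg V x <= d)%N) ->
  (#|N e :&: V| <= #|e| * d)%N.
Proof.
move=> Vd; apply: leq_trans (leq_card_bigcup (A := e) (F := fun x => [set f in V | x \in f]) _).
  apply/subset_leq_card/subsetP => f; rewrite !inE => /andP[/andP[_ /set0Pn[x /setIP[xe xf]]] fV].
  by apply/bigcupP; exists x; rewrite // inE fV.
by move=> x _; apply: Vd.
Qed.

(** A matching has at most one edge at each vertex of [e]. *)
Lemma card_nbr_indep I e : indep meets I -> (#|N e :&: I| <= #|e|)%N.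
Proof.
move=> /indepP iI; rewrite -[leqRHS]muln1; apply: leq_card_nbr => x.
apply/card_le1_eqP => f g /setIdP[fI xf] /setIdP[gI xg]; apply/eqP; rewrite eq_sym.
have := iI f g fI gI; rewrite negb_and negbK => /orP[//|].
rewrite negbK => /eqP fg0; have : x \in f :&: g by rewrite inE xf.
by rewrite fg0 inE.
Qed.

(* An edge meeting both [e] and [f] either contains their common vertex, or is
   determined by the two points in which it meets them. *)
Lemma card_common_nbr E V d e f : linear_hg E -> V \subset E -> e \in E -> f \in E ->
  (forall x, (hdeg V x <= d)%N) -> meets e f ->
  (#|N e :&: N f :&: V| <= d + #|e| * #|f|)%N.
Proof.
move=> HE VE eE fE Vd /andP[ef /set0Pn[x]]; rewrite inE => /andP[xe xf].
pose F (p : 'I_n * 'I_n) := [set g in V | (p.1 != p.2) && ((p.1 \in g) && (p.2 \in g))].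
have FS : N e :&: N f :&: V \subset
    [set g in V | x \in g] :|: \bigcup_(p in setX e f) F p.
  apply/subsetP => g; rewrite !inE => /andP[/andP[/andP[_ /set0Pn[y yeg]] /andP[_ /set0Pn[z zfg]]] gV].
  move: yeg zfg; rewrite !inE gV => /andP[ye yg] /andP[zf zg] /=.
  have [yz|yz] := eqVneq y z.
    suff -> : x = y by rewrite yg.
    by apply: (card_le1_eqP (HE e f eE fE ef)); rewrite inE ?xe ?ye//= yz.
  by apply/orP; right; apply/bigcupP; exists (y, z); rewrite !inE ?ye ?zf ?gV ?yz ?yg ?zg.
apply: leq_trans (subset_leq_card FS) _; apply: leq_trans (leq_card_setU _ _) _.
apply: leq_add; first exact: Vd.
rewrite -cardsX -[leqRHS]muln1; apply: leq_card_bigcup => -[y z] _.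
have [->|yz] := eqVneq y z.
  rewrite [F _](_ : _ = set0) ?cards0//.
  by apply/setP => g; rewrite !inE eqxx andbF.
apply: leq_trans (card_edges_pair (linear_hgS VE HE) yz).
by apply/subset_leq_card/subsetP => g; rewrite !inE => /and3P[-> _].
Qed.

(** [edge_colourable] colours non-edges too, hence [0 < k]; [inord] gives them some colour. *)
Lemma edge_colourableP E k : (0 < k)%N -> colourable meets E k -> edge_colourable E k.
Proof.
case: k => // k _ [c [ck cP]]; apply/existsP; exists [ffun e => inord (c e)].
apply/forall_inP => e eE; apply/forall_inP => f fE; apply/implyP => ef.
have := cP e f eE fE ef; apply: contraNN; rewrite !ffunE => /eqP/(congr1 val) /=.
by rewrite !inordK ?ck// => ->.
Qed.

Lemma chromatic_index_le E k : (0 < k)%N -> colourable meets E k ->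
  (chromatic_index E <= k)%N.
Proof.
move=> k0 /(edge_colourableP k0) ck; rewrite /chromatic_index.
by case: ex_minnP => j _; apply.
Qed.

End LinearHypergraph.

(** * Edges of medium size *)

Section MediumEdges.

Variables (R : realType) (n : nat).
Implicit Types (e f : {set 'I_n}) (V : {set {set 'I_n}}).

Notation N := (nbr (@meets n)).

(** Since [s <= 2 * s.-1]. This bounds the number of edges of size at least [s] that meet a given
    edge of size [s]. *)
Lemma mul_divn_pred (s : nat) : (1 < s)%N -> (s * (n %/ s.-1) <= 2 * n)%N.
Proof.
move=> s1; apply: (@leq_trans (2 * (n %/ s.-1 * s.-1))).
  by rewrite mulnCA mulnC leq_mul2l; apply/orP; right; lia.
by rewrite leq_mul2l leq_trunc_div.
Qed.

Lemma class_cover V (C s : nat) (delta : R) : linear_hg V -> (0 < C)%N -> (1 < s)%N ->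
  (forall e, e \in V -> (s <= #|e| < C * s)%N) -> 0 < delta ->
  (n %/ s.-1 + (C * s) ^ 2).+1%:R <= delta * n%:R ->
  2 * C%:R * expR (4 * C%:R ^+ 2) * delta <= 1 ->
  indep_cover (@meets n) V (C%:R / (4 * n%:R) : R) (C%:R / (4 * n%:R)).
Proof.
move=> HV C0 s1 Vs d0 Hd HC; set d := (n %/ s.-1 + _)%N in Hd.
have dn1 : 1 <= delta * n%:R by apply: le_trans Hd; rewrite ler1n.
have n0 : 0 < n%:R :> R by rewrite -(pmulr_rgt0 _ d0) (lt_le_trans ltr01).
have C0' : 0 < C%:R :> R by rewrite ltr0n.
have hdegV x : (hdeg V x <= n %/ s.-1)%N.
  by apply: hdeg_linear => // e /Vs/andP[].
have nne : n%:R != 0 :> R by rewrite gt_eqF.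
have dne : delta != 0 by rewrite gt_eqF.
have Cne : C%:R != 0 :> R by rewrite gt_eqF.
set X := expR _ in HC; have X0 : 0 < X by apply: expR_gt0.
(* Here [lam = 1 / (2 delta n)], [gamma = 1 / C^2] and [beta = 4 delta n X], so [beta lam = 2 X]
   exactly. For [p = C / (4 n)] the term [p beta = C X delta] is at most 1/2, and so is [p gamma D],
   as [D <= 2 C n]. *)
apply: (@sparse_cover R _ _ (@meets_sym n) (@meets_irr n) V (1 / (2 * (delta * n%:R)))
   (4 * (delta * n%:R) * X) (1 / C%:R ^+ 2) _ d (C * s * (n %/ s.-1))).
- by rewrite divr_gt0// mulr_gt0// mulr_gt0.
- by rewrite ler_pdivrMr; lra.
- by rewrite divr_gt0// exprn_gt0.
- move=> e f eV fV ef.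
  apply: leq_trans (card_common_nbr HV (subxx V) eV fV hdegV ef) _.
  rewrite leq_add2l expnS expn1 leq_mul//.
    by have /andP[_ /ltnW] := Vs e eV.
  by have /andP[_ /ltnW] := Vs f fV.
- move=> e eV; apply: leq_trans (leq_card_nbr e hdegV) _.
  by rewrite leq_mul2r; have /andP[_ /ltnW->] := Vs e eV; rewrite orbT.
(* As [d.+1 <= delta n], the power is at most [exp(1/2) <= 2]. *)
- apply: (@le_trans _ _ (expR (1 / 2))).
    apply: (@le_trans _ _ (expR (1 / (2 * (delta * n%:R))) ^+ d.+1)).
      by rewrite lerXn2r ?nnegrE ?expR_ge0 ?expR_ge1Dx// addr_ge0// divr_ge0//; lra.
    rewrite -expRM_natl ler_expR [X in _ * X]div1r ler_pdivrMr; last by lra.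
    by lra.
  have := expR_ge1Dx (- (1 / 2) : R); rewrite expRN -[(expR _)^-1]mul1r.
  by rewrite ler_pdivlMr ?expR_gt0//; lra.
- have -> : 4 / (1 / C%:R ^+ 2) = 4 * C%:R ^+ 2 :> R by rewrite div1r invrK.
  rewrite -/X le_eqVlt; apply/orP; left; apply/eqP. 
  by field; rewrite ?nne ?dne ?Cne.
- by rewrite divr_ge0// mulr_ge0// ltW.
have D2 : (C * s * (n %/ s.-1))%:R <= C%:R * (2 * n%:R) :> R.
  rewrite -mulnA natrM ler_pM2l// -[2]/(2%:R) -natrM ler_nat.
  exact: mul_divn_pred.
set D := _%:R in D2 *.
have -> : C%:R / (4 * n%:R) * (4 * (delta * n%:R) * X + 1 / C%:R ^+ 2 * D) =
    C%:R * X * delta + D / (4 * C%:R * n%:R).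
  by field; rewrite ?nne ?dne ?Cne.
have : D / (4 * C%:R * n%:R) <= 1 / 2.
  rewrite ler_pdivrMr; last by rewrite !mulr_gt0.
  by lra.
by lra.
Qed.

(** Within one parity a higher class lies at least two levels up, so its edges are more than [C]
    times as large as [e], and [e] meets at most [2 n / C] of them. Multiplied by [C / (4 n)] this
    is the 1/2 that [indep_cover_levels] allows. *)
Lemma parity_cover V (C j0 : nat) (b : bool) (u delta : R) : linear_hg V ->
  (1 < C)%N -> (0 < j0)%N ->
  (forall e, e \in V -> (C ^ j0 <= #|e|)%N) ->
  (forall e, e \in V -> #|e|%:R <= u) ->
  (forall e, e \in V -> odd (trunc_log C #|e|) = b) -> 0 < delta ->
  (n %/ (C ^ j0).-1).+1%:R + C%:R ^+ 2 * u ^+ 2 <= delta * n%:R ->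
  2 * C%:R * expR (4 * C%:R ^+ 2) * delta <= 1 ->
  indep_cover (@meets n) V (C%:R / (4 * n%:R) / 2 : R) (C%:R / (4 * n%:R)).
Proof.
move=> HV C1 j00 Vr Vu Vb d0 Hd HC.
have r1 : (1 < C ^ j0)%N by rewrite -{1}(expn0 C) ltn_exp2l.
apply: (indep_cover_levels (@meets_sym n) (lev := fun e => trunc_log C #|e|)).
- by rewrite divr_ge0// mulr_ge0.
- move=> j; have [->|[e0]] := set_0Vmem [set e in V | trunc_log C #|e| == j].
    exact: indep_cover0.
  move=> /setIdP[e0V /eqP e0j].
  have e0r := Vr _ e0V.
  have e00 : (0 < #|e0|)%N by apply: leq_trans e0r; apply: ltnW.
  have jj0 : (C ^ j0 <= C ^ j)%N.
    by rewrite leq_pexp2l ?(ltnW C1)// -e0j trunc_log_max.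
  have je0 : (C ^ j <= #|e0|)%N by rewrite -e0j trunc_logP.
  have HV' : linear_hg [set e in V | trunc_log C #|e| == j].
    by apply: linear_hgS HV; apply/subsetP => e /setIdP[].
  apply: (@class_cover _ C (C ^ j) delta) => //.
  + exact: ltnW.
  + exact: leq_trans jj0.
  + move=> e /setIdP[eV /eqP <-]; rewrite -expnS trunc_log_ltn// andbT trunc_logP//.
    by apply: leq_trans (Vr _ eV); apply: ltnW.
  (* The degree term is worst for the lowest class, the quadratic term for the largest size [u]. *)
  apply: le_trans Hd; rewrite -addSn natrD lerD//.
    by rewrite ler_nat ltnS leq_div2l//; lia.
  rewrite natrX natrM exprMn ler_wpM2l ?exprn_ge0// lerXn2r ?nnegrE//.
    by apply: le_trans (Vu _ e0V).
  by apply: le_trans (Vu _ e0V); rewrite ler_nat.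
move=> e eV; set j := trunc_log C #|e|.
have n_gt0 : (0 < n)%N.
  rewrite -[n]card_ord; apply: leq_trans (max_card e).
  by apply: leq_trans (Vr _ eV); apply: ltnW.
set V' := [set f in V | (C ^ j.+2 <= #|f|)%N].
have s1 : (1 < C ^ j.+2)%N by rewrite -{1}(expn0 C) ltn_exp2l.
have HV' : linear_hg V'.
  by apply: linear_hgS HV; apply/subsetP => f /setIdP[].
have hdegV' x : (hdeg V' x <= n %/ (C ^ j.+2).-1)%N.
  by apply: hdeg_linear => // f /setIdP[].
have sub : [set f in N e :&: V | (j < trunc_log C #|f|)%N] \subset N e :&: V'.
  apply/subsetP => f /setIdP[/setIP[fe fV] jf]; rewrite in_setI fe inE fV /=.
  have jf2 : (j.+2 <= trunc_log C #|f|)%N.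
    rewrite ltn_neqAle jf andbT; apply/eqP => jE.
    by have := Vb _ fV; rewrite -jE /= -(Vb _ eV) -/j; case: odd.
  apply: leq_trans (trunc_logP C1 _); first by rewrite leq_pexp2l ?(ltnW C1).
  by apply: leq_trans (Vr _ fV); apply: ltnW.
have cnt : (#|N e :&: V'| * C <= 2 * n)%N.
  apply: leq_trans (mul_divn_pred s1); rewrite mulnC.
  apply: (@leq_trans (C * (#|e| * (n %/ (C ^ j.+2).-1)))).
    by rewrite leq_mul2l leq_card_nbr ?orbT.
  by rewrite mulnA leq_mul2r expnS leq_mul2l ltnW ?orbT// trunc_log_ltn.
rewrite mulrA ler_pdivrMr ?mulr_gt0 ?ltr0n//.
apply: (@le_trans _ _ (2 * n)%:R); last by rewrite natrM; lra.
rewrite -natrM ler_nat; apply: leq_trans cnt; rewrite leq_mul2r.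
by rewrite subset_leq_card ?orbT.
Qed.

(** [(1 - a)^m <= exp(-a m) <= 1 / (1 + a m)], and this is already at most [c]. *)
Lemma exp_decay (c a : R) (m : nat) : 0 < c -> 0 < a -> a <= 1 ->
  1 / c <= a * m%:R -> (1 - a) ^+ m <= c.
Proof.
move=> c0 a0 a1 cam; apply: (@le_trans _ _ (expR (- a) ^+ m)).
  by rewrite lerXn2r ?nnegrE ?expR_ge0 ?subr_ge0// expR_ge1Dx.
rewrite -expRM_natl mulrN expRN -[leLHS]mul1r ler_pdivrMr ?expR_gt0//.
have := expR_ge1Dx (m%:R * a); set X := expR _ => hX.
by move: cam; rewrite ler_pdivrMr//; nra.
Qed.

(** One palette of size [m] serves the random matchings, the other the greedy finish. *)
Lemma parity_colourable V (C j0 m : nat) (b : bool) (u c delta : R) : linear_hg V ->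
  (1 < C)%N -> (0 < j0)%N ->
  (forall e, e \in V -> (C ^ j0 <= #|e|)%N) ->
  (forall e, e \in V -> #|e|%:R <= u) ->
  (forall e, e \in V -> odd (trunc_log C #|e|) = b) -> 0 < delta ->
  (n %/ (C ^ j0).-1).+1%:R + C%:R ^+ 2 * u ^+ 2 <= delta * n%:R ->
  2 * C%:R * expR (4 * C%:R ^+ 2) * delta <= 1 ->
  u <= Num.sqrt n%:R -> 0 < c -> c <= 1 -> 2 ^+ 14 <= C%:R * c ^+ 2 ->
  (C <= 8 * n)%N -> c * n%:R / 16 <= m%:R ->
  n%:R ^+ 2 < expR (c * Num.sqrt n%:R / 32) ->
  colourable (@meets n) V (m + m).
Proof.
move=> HV C1 j00 Vr Vu Vb d0 Hd HC ux c0 c1 Cc Cn mn big.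
have r1 : (1 < C ^ j0)%N by rewrite -{1}(expn0 C) ltn_exp2l.
have n0 : 0 < n%:R :> R by rewrite ltr0n; move: C1 Cn; lia.
set x : R := Num.sqrt n%:R in ux big.
have x0 : 0 < x by rewrite sqrtr_gt0.
have xx : n%:R = x * x by rewrite -expr2 sqr_sqrtr// ltW.
have Cp : 0 < C%:R :> R by rewrite ltr0n ltnW.
have C8 : C%:R <= 8 * n%:R :> R by rewrite -[8]/(8%:R) -natrM ler_nat.
have aE : C%:R / (4 * n%:R) / 2 / 2 = C%:R / (16 * n%:R) :> R.
  by field; rewrite gt_eqF.
apply: (@colourable_cover _ _ (@meets_sym n) (@meets_irr n) R V (fun e => #|e|)
  (C%:R / (4 * n%:R) / 2) (C%:R / (4 * n%:R)) (1 / x) (2 * n)).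
- exact: (parity_cover HV C1 j00 Vr Vu Vb d0 Hd HC).
- by rewrite !divr_ge0// mulr_ge0.
- rewrite ler_pdivrMr// ler_pdivrMr ?mulr_gt0//; lra.
- by rewrite divr_ge0// ltW.
- move=> I e iI IV eV; rewrite mul1r mulrC ler_pdivrMr// mul1r.
  apply: le_trans ux; apply: le_trans (Vu _ eV); rewrite ler_nat.
  apply: leq_trans (card_nbr_indep e iI); apply: subset_leq_card.
  by apply: setSI; apply/subsetP => f /setIdP[/setIP[]].
- move=> e eV; have e1 : (1 < #|e|)%N by apply: leq_trans (Vr _ eV).
  apply: leq_trans (mul_divn_pred e1).
  set V' := [set f in V | (#|e| <= #|f|)%N].
  apply: (@leq_trans #|N e :&: V'|).
    apply/subset_leq_card/subsetP => f /setIdP[/setIP[fe fV] ef].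
    by rewrite in_setI fe inE fV.
  apply: leq_card_nbr => y; apply: hdeg_linear => //.
    by apply: linear_hgS HV; apply/subsetP => f /setIdP[].
  by move=> f /setIdP[].
(* From [m >= c n / 16] the exponent [m C / (16 n)] is at least [C c / 256], which reaches [64 / c]
   because [C c^2 >= 2^14]. *)
rewrite aE; have decay : (1 - C%:R / (16 * n%:R)) ^+ m <= c / 64.
  apply: exp_decay; first lra.
  - by rewrite divr_gt0// mulr_gt0.
  - by rewrite ler_pdivrMr ?mulr_gt0//; lra.
  rewrite mul1r invf_div ler_pdivrMr//.
  rewrite [leRHS](_ : _ = C%:R * m%:R * c / (16 * n%:R)); last by field; rewrite gt_eqF.
  rewrite ler_pdivlMr ?mulr_gt0//.
  have : C%:R * c * (c * n%:R / 16) <= C%:R * c * m%:R.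
    by rewrite ler_wpM2l// mulr_ge0// ltW.
  have : 2 ^+ 14 * n%:R <= C%:R * c ^+ 2 * n%:R by rewrite ler_pM2r.
  lra.
have V2 : #|V|%:R <= n%:R ^+ 2 :> R.
  rewrite -natrX ler_nat; have := card_linear HV (s := 2) _.
  rewrite muln1 expnS expn1 => H; apply: leq_trans (H _); first by rewrite leq_pmulr.
  by move=> e eV; apply: leq_trans (Vr _ eV).
(* The bound [2 n] on the neighbours shrinks to [c n / 32], giving exponent [c x / 32]. The target
   exponent [m / x] is at least twice that, and the surplus absorbs [n^2]. *)
apply: (@le_lt_trans _ _ (n%:R ^+ 2 * expR (c * x / 32))).
  apply: ler_pM => //; rewrite ?expR_ge0// ler_expR.
  rewrite natrM xx [leRHS](_ : _ = 1 / x * (c / 64) * (2%:R * (x * x))); last first.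
    by field; rewrite gt_eqF.
  rewrite ler_wpM2r ?mulr_ge0// ?(ltW x0)// ler_wpM2l ?divr_ge0// ?(ltW x0)//.
  by rewrite -xx.
apply: (@lt_le_trans _ _ (expR (c * x / 32) * expR (c * x / 32))).
  by rewrite ltr_pM2r ?expR_gt0.
rewrite -expRD ler_expR div1r [leRHS]mulrC ler_pdivlMr//.
by move: mn; rewrite xx; lra.
Qed.

End MediumEdges.

(** * Small and large edges, and the choice of constants *)

Lemma sqr_lt_expR (R : realType) (c x : R) : 0 < c -> 0 < x ->
  32 ^+ 5 * 120 <= c ^+ 5 * x -> (x ^+ 2) ^+ 2 < expR (c * x / 32).
Proof.
(* The fifth-order term of the exponential series already dominates [x^4]; the constant term 1 makes
   the inequality strict. *)
move=> c0 x0 H; have := @expR_ge1Dxn R (c * x / 32) 4 _.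
have y0 : 0 <= c * x / 32 by rewrite divr_ge0// mulr_ge0// ltW.
move=> /(_ y0); apply: lt_le_trans.
have -> : (c * x / 32) ^+ 5 / 5`!%:R = c ^+ 5 * x * x ^+ 4 / (32 ^+ 5 * 120).
  by rewrite (_ : 5`!%:R = 120) //; field.
rewrite -exprM -[ltLHS]add0r ltr_leD// ler_pdivlMr ?mulr_gt0 ?exprn_gt0//.
by rewrite mulrC ler_pM2r// exprn_gt0.
Qed.

(** An edge with fewer than [r] vertices meets at most [r * D] edges, so greedy colouring in any
    order works. *)
Lemma small_colourable (R : realType) (n r k : nat) (E : {set {set 'I_n}}) (D : R) :
  0 <= D -> (forall x, (hdeg E x)%:R <= D) -> r%:R * D < k%:R ->
  colourable (@meets n) [set e in E | (#|e| < r)%N] k.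
Proof.
move=> D0 HD Hk; set S := [set e in E | _].
apply: (colourable_greedy (@meets_sym n) (@meets_irr n) (rank := fun=> 0%N)).
move=> e /setIdP[eE er].
have hS x : (hdeg S x <= Num.truncn D)%N.
  rewrite truncn_ge_nat//; apply: le_trans (HD x); rewrite ler_nat.
  by apply/subset_leq_card/subsetP => f; rewrite !inE => /andP[/andP[-> _] ->].
apply: (@leq_ltn_trans (r * Num.truncn D)).
  apply: (@leq_trans #|nbr (@meets n) e :&: S|).
    by apply/subset_leq_card/subsetP => f /setIdP[].
  apply: leq_trans (leq_card_nbr e hS) _.
  by rewrite leq_mul2r ltnW ?orbT.
rewrite -(ltr_nat R); apply: le_lt_trans Hk.
by rewrite natrM ler_wpM2l// truncn_le.
Qed.

(** Apply [card_linear] with [s] the integer part of [y]; for [y >= 4] one has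
    [y^2 <= 4 s (s - 1)]. *)
Lemma card_large (R : realType) (n : nat) (E : {set {set 'I_n}}) (y : R) :
  linear_hg E -> 4 <= y -> (forall e, e \in E -> y <= #|e|%:R) ->
  #|E|%:R * y ^+ 2 <= 4 * n%:R ^+ 2.
Proof.
move=> HE y4 Ey; have y0 : 0 <= y by lra.
have /andP[sy ys] := truncn_itv y0; set s := Num.truncn y in sy ys.
have := @card_linear n E s HE.
have Es e : e \in E -> (s <= #|e|)%N.
  by move=> /Ey ye; rewrite -(ler_nat R); apply: le_trans ye.
move=> /(_ Es); rewrite -(ler_nat R) !natrM.
have s0 : (0 < s)%N by rewrite truncn_gt0; lra.
have s1 : s.-1%:R = s%:R - 1 :> R by rewrite -subn1 natrB.
rewrite s1 => H; move: ys; rewrite -natr1 => ys.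
have : y ^+ 2 <= 4 * (s%:R * (s%:R - 1)) by nra.
have C0 : 0 <= #|E|%:R :> R by [].
by move=> /(ler_wpM2l C0); rewrite expr2 [n%:R ^+ 2]expr2; lra.
Qed.

Theorem theorem1p3 (R : realType) :
  forall eps : R, 0 < eps ->
  exists (n0 : nat) (eta : R), 0 < eta /\
    forall (n : nat), (n0 <= n)%N ->
    forall E : {set {set 'I_n}},
      hypergraph E -> linear_hg E ->
      (forall v : 'I_n, (hdeg E v)%:R <= eta * n%:R) ->
      (forall e, e \in E ->
         ~ (eta * Num.sqrt (n%:R : R) < (#|e|)%:R /\
            (#|e|)%:R < Num.sqrt (n%:R : R) / eta)) ->
      (chromatic_index E)%:R <= eps * n%:R.
Proof.
move=> eps eps0; pose c := Num.min eps 1.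
have c0 : 0 < c by rewrite lt_min eps0 ltr01.
have c1 : c <= 1 by rewrite ge_min lexx orbT.
have ceps : c <= eps by rewrite ge_min lexx.
have gtS (y : R) : y < (Num.truncn y).+1%:R by apply: truncnS_gt.
(* Large enough for the decay in [parity_colourable]; the [.+2] also gives [1 < C]. *)
pose C := (Num.truncn (2 ^+ 14 / c ^+ 2)).+2.
have Cc : 2 ^+ 14 <= C%:R * c ^+ 2.
  rewrite -ler_pdivrMr ?exprn_gt0//; apply: ltW; apply: lt_trans (gtS _) _.
  by rewrite ltr_nat.
have C1 : (1 < C)%N by [].
have Cge1 : 1 <= C%:R :> R by rewrite ler1n.
(* Only the recorded inequalities are kept and [C] becomes opaque; likewise for [delta], [eta] and
   [K] below. *)
move: C Cc C1 Cge1 => C Cc C1 Cge1.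
have [X XE] : exists X : R, expR (4 * C%:R ^+ 2) = X by eexists.
have X1 : 1 <= X.
  rewrite -XE.
  by apply: le_trans (expR_ge1Dx _); rewrite lerDl mulr_ge0// exprn_ge0.
pose delta : R := 1 / (2 * C%:R * X).
have d0 : 0 < delta by rewrite divr_gt0// !mulr_gt0//; lra.
have Xd : 2 * C%:R * X * delta <= 1.
  by rewrite /delta mulrC divfK// gt_eqF// !mulr_gt0//; lra.
have CX : 1 <= C%:R * X by apply: mulr_ege1.
have d1 : delta <= 1 by rewrite ler_pdivrMr; lra.
move: delta d0 Xd d1 => delta d0 Xd d1.
(* Since [r = C ^ j0] exceeds [4 / delta], edges of size at least [r] give degrees at most
   [delta n / 4]. *)
pose j0 := (Num.truncn (4 / delta)).+1.
have j0d : 4 / delta < j0%:R by apply: gtS.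
pose r := (C ^ j0)%N.
have jr : (j0 < r)%N by apply: ltn_expl.
have r2 : 2 <= r%:R :> R by rewrite -[2]/(2%:R) ler_nat; apply: leq_ltn_trans jr.
(* Serves three bounds: [r eta <= c / 8] for small edges, [C^2 eta^2 <= delta / 4] for medium ones
   and [eta <= c / 16] for large ones. *)
pose eta : R := delta * c / (8 * r%:R * C%:R ^+ 2).
have C2 : 1 <= C%:R ^+ 2 :> R by rewrite exprn_ege1.
have r0 : 0 < r%:R :> R by lra.
have Cgt0 : 0 < C%:R :> R by lra.
have C20 : 0 < C%:R ^+ 2 :> R by lra.
have eta0 : 0 < eta by rewrite divr_gt0// !mulr_gt0.
have etaE : eta * (8 * r%:R * C%:R ^+ 2) = delta * c.
  by rewrite /eta divfK// gt_eqF// !mulr_gt0.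
move: eta eta0 etaE => eta eta0 etaE.
have dc : delta * c <= c by rewrite ler_piMl// ltW.
have dc' : delta * c <= delta by rewrite ler_piMr// ltW.
have etar : r%:R * eta <= c / 8.
  have : r%:R * eta <= r%:R * eta * C%:R ^+ 2 by rewrite ler_peMr// mulr_ge0// ltW.
  lra.
have eta2 : 2 * eta <= r%:R * eta by rewrite ler_wpM2r// ltW.
have eta16 : eta <= c / 16 by lra.
have etad : C%:R ^+ 2 * eta ^+ 2 <= delta / 4.
  have e2 : C%:R ^+ 2 * (2 * eta) <= C%:R ^+ 2 * (r%:R * eta) by rewrite ler_wpM2l// ltW.
  have : C%:R ^+ 2 * eta * eta <= C%:R ^+ 2 * eta * 1.
    by rewrite ler_wpM2l ?mulr_ge0 ?(ltW C20) ?(ltW eta0)//; lra.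
  lra.
pose K : R := 32 ^+ 5 * 120 / c ^+ 5.
have Kc : 32 ^+ 5 * 120 = K * c ^+ 5 by rewrite divfK// expf_neq0// gt_eqF.
have K0 : 0 <= K by rewrite divr_ge0 ?mulr_ge0 ?exprn_ge0// ltW.
move: K Kc K0 => K Kc K0.
(* These make [n] large enough for [delta n >= 4], [c n >= 10] and [sqrt n >= K]. *)
have [a1 ha1] : exists k : nat, 4 / delta < k%:R by eexists; apply: gtS.
have [a2 ha2] : exists k : nat, 10 / c < k%:R by eexists; apply: gtS.
have [a3 ha3] : exists k : nat, K ^+ 2 < k%:R by eexists; apply: gtS.
pose n0 := (a1 + a2 + a3 + C)%N.
exists n0, eta; split=> // n n0n E _ HE Hdeg Hsize.
have leN (y : R) k : y < k%:R -> (k <= n0)%N -> y <= n%:R.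
  by move=> yk kn; apply: le_trans (ltW yk) _; rewrite ler_nat (leq_trans kn).
have aN : [/\ a1 <= n0, a2 <= n0, a3 <= n0 & C <= n0]%N.
  by rewrite /n0; clear; split; lia.
have [a1n a2n a3n Cn0] := aN.
have nd : 4 / delta <= n%:R by apply: (leN _ _ ha1).
have nc : 10 / c <= n%:R by apply: (leN _ _ ha2).
have nK : K ^+ 2 <= n%:R by apply: (leN _ _ ha3).
have Cn : (C <= 8 * n)%N.
  by apply: leq_trans (leq_trans Cn0 n0n) _; rewrite leq_pmull.
have n1 : 1 <= n%:R :> R by rewrite ler1n; apply: leq_trans n0n; apply: leq_trans Cn0; apply: ltnW.
pose x : R := Num.sqrt n%:R.
have xx : x ^+ 2 = n%:R by rewrite sqr_sqrtr//; lra.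
have x0 : 0 <= x by apply: sqrtr_ge0.
have x1 : 1 <= x by rewrite -sqrtr1 ler_sqrt//; lra.
have xK : K <= x by rewrite -(ger0_norm K0) -sqrtr_sqr ler_sqrt//; lra.
have {xK Kc K0 nK} big : n%:R ^+ 2 < expR (c * x / 32).
  rewrite -xx; apply: sqr_lt_expR => //; first by lra.
  by rewrite Kc mulrC ler_pM2l// exprn_gt0.
pose S := [set e in E | (#|e| < r)%N].
pose M b := [set e in E | [&& (r <= #|e|)%N, #|e|%:R <= eta * x &
  odd (trunc_log C #|e|) == b]].
pose L := [set e in E | x / eta <= #|e|%:R].
have Ecover : E \subset S :|: (M true :|: M false) :|: L.
  apply/subsetP => e eE; rewrite !inE eE /=.
  have [|re] := ltnP; first by [].
  have [_|ex] := lerP #|e|%:R (eta * x); first by case: odd.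
  by rewrite leNgt; apply/negP => ex'; apply: (Hsize e eE).
(* Budget: about [c n / 8] colours each for [S], the two parities and [L]. Rounding adds at most 5,
   and [c n / 2 + 5 <= c n] because [c n >= 10]. *)
pose k := (Num.truncn (c * n%:R / 8)).+1; pose m := (Num.truncn (c * n%:R / 16)).+1.
have kS : colourable (@meets n) S k.
  apply: (small_colourable (D := eta * n%:R)) => //; first by rewrite mulr_ge0// ltW.
  apply: le_lt_trans (gtS _); rewrite mulrA.
  by have := ler_wpM2r (le_trans ler01 n1) etar; lra.
have mM b : colourable (@meets n) (M b) (m + m).
  apply: (@parity_colourable R n (M b) C j0 m b (eta * x) c delta); rewrite ?XE//.
  - by apply: linear_hgS HE; apply/subsetP => e /setIdP[].
  - by move=> e /setIdP[_ /and3P[]].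
  - by move=> e /setIdP[_ /and3P[]].
  - by move=> e /setIdP[_ /and3P[_ _ /eqP]].
  (* Each of the three summands is at most [delta n / 4]. *)
  - rewrite -/r exprMn xx -natr1.
    have rp : 4 / delta <= r.-1%:R :> R.
      by apply: le_trans (ltW j0d) _; rewrite ler_nat -ltnS (ltn_predK jr).
    have : (n %/ r.-1)%:R <= delta * n%:R / 4 :> R.
      have : (n %/ r.-1)%:R * r.-1%:R <= n%:R :> R by rewrite -natrM ler_nat leq_trunc_div.
      move=> h; have h2 := ler_wpM2l (ler0n R (n %/ r.-1)) rp.
      have := le_trans h2 h; rewrite mulrA ler_pdivrMr//; lra.
    have : 4 <= delta * n%:R by move: nd; rewrite ler_pdivrMr//; lra.
    have := ler_wpM2r (le_trans ler01 n1) etad; rewrite mulrA.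
    lra.
  - by rewrite -/x ler_piMl//; lra.
  - exact: ltW.
have cL : #|L|%:R <= c * n%:R / 8.
  have xe : 16 * x <= x / eta by rewrite ler_pdivlMr//; nra.
  have HL : linear_hg L by apply: linear_hgS HE; apply/subsetP => e /setIdP[].
  have y4 : 4 <= x / eta by lra.
  have := card_large HL y4; move=> /(_ _)H.
  have {H} : #|L|%:R * (x / eta) ^+ 2 <= 4 * n%:R ^+ 2.
    by apply: H => e /setIdP[].
  rewrite expr_div_n xx mulrA ler_pdivrMr ?exprn_gt0// => h.
  have {h} h : #|L|%:R <= 4 * n%:R * eta ^+ 2.
    by rewrite -(ler_pM2r (lt_le_trans ltr01 n1)); apply: le_trans h _; lra.
  apply: le_trans h _; have : 4 * eta ^+ 2 <= c / 8 by nra.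
  by move=> /(ler_wpM2r (le_trans ler01 n1)); lra.
have tot := colourableU (colourableU kS (colourableU (mM true) (mM false)))
  (colourable_card (@meets_sym n) (@meets_irr n) L).
have {tot} := colourableS Ecover (leqnn _) tot.
move=> /chromatic_index_le; set t := (_ + _)%N => ct.
apply: (@le_trans _ _ t%:R); first by rewrite ler_nat ct// /t -addnA ltn_addr.
have kb : k%:R <= c * n%:R / 8 + 1.
  by rewrite /k -natr1 lerD2r truncn_le divr_ge0// mulr_ge0 ?(ltW c0).
have mb : m%:R <= c * n%:R / 16 + 1.
  by rewrite /m -natr1 lerD2r truncn_le divr_ge0// mulr_ge0 ?(ltW c0).
rewrite /t !natrD.
have : c * n%:R <= eps * n%:R by rewrite ler_wpM2r.
have : 10 <= c * n%:R by move: nc; rewrite ler_pdivrMr//; lra.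
lra.
Qed.
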